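(* Let $\mathbb X_i=\langle X_i,\rho_i\rangle$, $i\in I$, be pairwise disjoint connected $L_b$-structures. Then $\bigcup_{i\in I}\mathbb X_i$ is reversible iff the following holds: whenever $f:I\to I$ is a surjection and $g_i\in\mathrm{Mono}(\mathbb X_i,\mathbb X_{f(i)})$ for $i\in I$ are such that for every $j\in I$ the family $\{g_i[X_i]: i\in f^{-1}[\{j\}]\}$ is a partition of $X_j$, then $f$ is a bijection and $g_i\in\mathrm{Iso}(\mathbb X_i,\mathbb X_{f(i)})$ for all $i\in I$.
   Context: An $L_b$-structure is a pair $\langle X,\rho\rangle$ with $\rho\subseteq X^2$. A homomorphism $f:\langle X,\rho\rangle\to\langle Y,\sigma\rangle$ is a map with $\langle x,y\rangle\in\rho\Rightarrow\langle f(x),f(y)\rangle\in\sigma$; $\mathrm{Mono}(\mathbb X,\mathbb Y)$ is the set of injective homomorphisms; $\mathrm{Iso}(\mathbb X,\mathbb Y)$ the set of isomorphisms. A condensation is a bijective homomorphism; a structure is reversible iff every condensation from it to itself is an automorphism. The components of $\langle X,\rho\rangle$ are the classes of the smallest equivalence relation on $X$ containing $\rho$; connected means exactly one component. Pairwise disjoint means disjoint domains, and $\bigcup_{i\in I}\mathbb X_i=\langle\bigcup_i X_i,\bigcup_i\rho_i\rangle$. *)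

(* Defs.v *)
From mathcomp Require Import all_boot.
From mathcomp Require Import boolp classical_sets functions.

Set Implicit Arguments.
Unset Strict Implicit.
Unset Printing Implicit Defensive.

Local Open Scope classical_set_scope.

(* The structures under consideration have as domains subsets of one ambient
   type U, so that disjointness and unions are literal.  A map between the
   domains A and B is represented by a function U -> U sending A into B; its
   values outside A are irrelevant to every notion below. *)
Record lb_structure (U : Type) := LbStructure {
  dom : set U ;
  rho : set (U * U) ;
  rho_sub : rho `<=` dom `*` dom
}.

Section LbStructures.
Variable U : Type.
Implicit Types (X Y : lb_structure U) (f : U -> U).

Definition lb_hom X Y f : Prop :=
  set_fun (dom X) (dom Y) f /\
  (forall x y, rho X (x, y) -> rho Y (f x, f y)).

Definition lb_mono X Y f : Prop :=
  lb_hom X Y f /\ set_inj (dom X) f.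

Definition lb_iso X Y f : Prop :=
  set_bij (dom X) (dom Y) f /\
  (forall x y, dom X x -> dom X y -> (rho X (x, y) <-> rho Y (f x, f y))).

Definition lb_condensation X Y f : Prop :=
  lb_hom X Y f /\ set_bij (dom X) (dom Y) f.

Definition lb_reversible X : Prop :=
  forall f, lb_condensation X X f -> lb_iso X X f.

Definition equivalence_on (A : set U) (E : set (U * U)) : Prop :=
  [/\ E `<=` A `*` A,
      forall x, A x -> E (x, x),
      forall x y, E (x, y) -> E (y, x)
    & forall x y z, E (x, y) -> E (y, z) -> E (x, z)].

Definition lb_conn X : set (U * U) :=
  \bigcap_(E in [set E | equivalence_on (dom X) E /\ rho X `<=` E]) E.

Definition lb_components X : set (set U) :=
  [set [set y | lb_conn X (x, y)] | x in dom X].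

Definition lb_connected X : Prop := exists C, lb_components X = [set C].

Section Union.
Variables (I : Type) (X : I -> lb_structure U).

Definition lb_disjoint : Prop := trivIset [set: I] (fun i => dom (X i)).

Lemma lb_union_subproof :
  \bigcup_i rho (X i) `<=` (\bigcup_i dom (X i)) `*` (\bigcup_i dom (X i)).
Proof.
by move=> p [i _ /rho_sub[/= p1 p2]]; split; exists i.
Qed.

Definition lb_union : lb_structure U := LbStructure lb_union_subproof.

End Union.
End LbStructures.

(* Main.v *)
Require Import Defs.
From mathcomp Require Import all_boot.
From mathcomp Require Import boolp classical_sets functions.

Set Implicit Arguments.
Unset Strict Implicit.
Unset Printing Implicit Defensive.

Local Open Scope classical_set_scope.

(** A condensation of the union maps each connected [X i] into a single
    [X (f i)], hence it is the same thing as a surjection [f] together with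
    monomorphisms [g i] whose images partition the targets. If the glued map is
    an automorphism, then the images [g i @` dom (X i)] inside [X j] are unions
    of components of [X j], so connectedness of [X j] leaves only one of them. *)

Lemma lb_connected_nonempty (U : Type) (X : lb_structure U) :
  lb_connected X -> dom X !=set0.
Proof.
case=> C XC; have [x Xx _] : lb_components X C by rewrite XC.
by exists x.
Qed.

(** [E] is one of the relations intersected in [lb_conn X], which has a single class. This is how
    connectedness is used throughout: to put all points in one block, check that edges stay inside
    blocks. *)
Lemma lb_connected_equiv (U : Type) (X : lb_structure U) (E : set (U * U)) :
  lb_connected X -> equivalence_on (dom X) E -> rho X `<=` E ->
  forall x y, dom X x -> dom X y -> E (x, y).
Proof.
move=> [C XC] eqE rhoE x y Xx Xy.
have class_eq z : dom X z -> [set y | lb_conn X (z, y)] = C.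
  move=> Xz; have : lb_components X [set y | lb_conn X (z, y)] by exists z.
  by rewrite XC.
have yy : [set z | lb_conn X (y, z)] y.
  by move=> F [[_ Frefl _ _] _]; exact: Frefl.
by move: yy; rewrite (class_eq _ Xy) -(class_eq _ Xx) => /(_ E); apply.
Qed.

Section Union.
Variables (U I : Type) (X : I -> lb_structure U).
Hypotheses (Xdisj : lb_disjoint X) (Xconn : forall i, lb_connected (X i)).

Lemma lb_disjoint_eq i j x : dom (X i) x -> dom (X j) x -> i = j.
Proof. by move=> Xix Xjx; apply: Xdisj => //; exists x. Qed.

Lemma lb_union_rho i x y :
  dom (X i) x \/ dom (X i) y -> rho (lb_union X) (x, y) -> rho (X i) (x, y).
Proof.
move=> Xi [k _ rxy]; have [/= Xkx Xky] := rho_sub rxy.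
suff -> : i = k by [].
by case: Xi => [Xix|Xiy]; [exact: lb_disjoint_eq Xkx|exact: lb_disjoint_eq Xky].
Qed.

Section Glue.
Variables (f : I -> I) (g : I -> U -> U).
Hypothesis fsurj : set_surj [set: I] [set: I] f.
Hypothesis gmono : forall i, lb_mono (X i) (X (f i)) (g i).
Hypothesis gpart : forall j,
  partition (f @^-1` [set j]) (fun i => g i @` dom (X i)) (dom (X j)).

Lemma glue_exists :
  exists h : U -> U, forall i x, dom (X i) x -> h x = g i x.
Proof.
suff /choice : forall x, exists y, forall i, dom (X i) x -> y = g i x.
  by move=> [h hg]; exists h => i x; exact: hg.
move=> x; have [[i Xix]|noX] := pselect (exists i, dom (X i) x).
  by exists (g i x) => k Xkx; rewrite (lb_disjoint_eq Xix Xkx).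
(* Outside the union the value is arbitrary. *)
by exists x => i Xix; case: noX; exists i.
Qed.

(** A common value forces [f i = f k] by disjointness of the targets; then disjointness of the
    blocks gives [i = k], and injectivity of [g i] gives [x = y]. *)
Lemma image_eq i k x y :
  dom (X i) x -> dom (X k) y -> g i x = g k y -> i = k /\ x = y.
Proof.
move=> Xix Xky gxy.
have [[gi_fun _] gi_inj] := gmono i; have [[gk_fun _] _] := gmono k.
have fik : f i = f k.
  apply: (@lb_disjoint_eq _ _ (g i x)); first exact: gi_fun.
  by rewrite gxy; exact: gk_fun.
have [_ gtriv _] := gpart (f k).
have eik : i = k.
  apply: gtriv => //; exists (g i x); split; first by exists x.
  by exists y.
split=> //; move: Xky gxy; rewrite -eik => Xiy gxy.
by apply: gi_inj => //; rewrite inE.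
Qed.

Lemma glue_condensation h : (forall i x, dom (X i) x -> h x = g i x) ->
  lb_condensation (lb_union X) (lb_union X) h.
Proof.
move=> hg; have hfun : set_fun (dom (lb_union X)) (dom (lb_union X)) h.
  move=> x [i _ Xix]; exists (f i) => //; rewrite (hg _ _ Xix).
  by have [[gi_fun _] _] := gmono i; exact: gi_fun.
split; [split|split] => //.
- move=> x y [i _ rxy]; have [/= Xix Xiy] := rho_sub rxy; exists (f i) => //.
  rewrite (hg _ _ Xix) (hg _ _ Xiy).
  by have [[_ gi_hom] _] := gmono i; exact: gi_hom.
- move=> x y; rewrite !inE => -[i _ Xix] [k _ Xky].
  by rewrite (hg _ _ Xix) (hg _ _ Xky) => /(image_eq Xix Xky)[].
- move=> y [j _]; have [<- _ _] := gpart j.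
  move=> [i _ [x Xix <-]]; exists x; first by exists i.
  exact: hg.
Qed.

Lemma reversible_glue : lb_reversible (lb_union X) ->
  set_bij [set: I] [set: I] f /\ (forall i, lb_iso (X i) (X (f i)) (g i)).
Proof.
move=> Xrev; have [h hg] := glue_exists.
have [_ hrho] := Xrev _ (glue_condensation hg).
(* The automorphism [h] reflects edges. Allowing [i] and [k] to differ is essential: the reflected
   edge lies in [X i], so it will force [k = i]. *)
have grho i k x y : dom (X i) x -> dom (X k) y ->
    rho (X (f i)) (g i x, g k y) -> rho (X i) (x, y).
  move=> Xix Xky; rewrite -(hg _ _ Xix) -(hg _ _ Xky) => rxy.
  apply: lb_union_rho; first by left.
  by apply/hrho; [exists i|exists k|exists (f i)].
have finj i k : f i = f k -> i = k.
  move=> fik; pose j := f k.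
  (* [E] is the equivalence whose classes are the blocks of the partition of [dom (X j)]. *)
  pose E : set (U * U) := [set p | exists2 m, f m = j &
    (g m @` dom (X m)) p.1 /\ (g m @` dom (X m)) p.2].
  have [gcover gtriv _] := gpart j.
  have Eequiv : equivalence_on (dom (X j)) E.
    split.
    - move=> [u v] [m fm [/= gu gv]].
      by split; rewrite /= -gcover; exists m.
    - by move=> u; rewrite -gcover => -[m fm gu]; exists m.
    - by move=> u v [m fm [gu gv]]; exists m.
    - move=> u v w [m fm [/= gu gv]] [n fn [/= gv' gw]].
      exists m => //; split => //=.
      suff -> : m = n by [].
      by apply: gtriv => //; exists v.
  (* An edge between blocks [m] and [n] pulls back to an edge of [X m] ending in [X n], so the
     blocks coincide. *)
  have Erho : rho (X j) `<=` E.
    move=> [u v] ruv; have [/=] := rho_sub ruv; rewrite -gcover.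
    move=> [m fm gu] [n fn gv]; exists m => //; split=> //=.
    case: gu gv ruv => x Xmx <- [y Xny <-]; rewrite -fm => ruv.
    have [/= _ Xmy] := rho_sub (grho _ _ _ _ Xmx Xny ruv).
    by rewrite -(lb_disjoint_eq Xmy Xny); exists y.
  have [x Xix] := lb_connected_nonempty (Xconn i).
  have [y Xky] := lb_connected_nonempty (Xconn k).
  have Xjx : dom (X j) (g i x) by rewrite -gcover; exists i => //; exists x.
  have Xjy : dom (X j) (g k y) by rewrite -gcover; exists k => //; exists y.
  have [m _ [/= [x' Xmx' gx] [y' Xmy' gy]]] :=
    lb_connected_equiv (Xconn j) Eequiv Erho Xjx Xjy.
  have [<- _] := image_eq Xmx' Xix gx.
  by have [] := image_eq Xmy' Xky gy.
split; first by split=> // i k _ _; exact: finj.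
move=> i; have [[gi_fun gi_hom] gi_inj] := gmono i.
split; first split=> //.
  (* Since [f] is injective, the image of [g i] is the only block covering [X (f i)]. *)
  by move=> y; have [<- _ _] := gpart (f i) => -[k /finj ->].
by move=> x y Xix Xiy; split; [exact: gi_hom|exact: grho].
Qed.

End Glue.

Section Split.
Variable h : U -> U.
Hypothesis hcond : lb_condensation (lb_union X) (lb_union X) h.

Lemma condensation_component i :
  exists j, forall x, dom (X i) x -> dom (X j) (h x).
Proof.
have [[hfun hhom] _] := hcond.
(* Two points are related when [h] sends them into the same component; transitivity comes from
   disjointness of the components. *)
pose E : set (U * U) := [set p | (dom (X i) p.1 /\ dom (X i) p.2) /\
  exists2 j, dom (X j) (h p.1) & dom (X j) (h p.2)].
have Eequiv : equivalence_on (dom (X i)) E.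
  split.
  - by move=> p [].
  - move=> x Xix; split => //.
    have [|j _ Xjhx] := hfun x; first by exists i.
    by exists j.
  - by move=> x y [[? ?] [j ? ?]]; split => //; exists j.
  - move=> x y z [[Xx _] [j /= jx jy]] [[_ Xz] [k /= ky kz]]; split => //.
    by exists j => //; rewrite (lb_disjoint_eq jy ky).
have Erho : rho (X i) `<=` E.
  move=> [x y] rxy; split; first exact: (rho_sub rxy).
  have [|j _ /rho_sub[]] := hhom x y; first by exists i.
  by exists j.
have [x Xix] := lb_connected_nonempty (Xconn i).
have [|j _ Xjhx] := hfun x; first by exists i.
exists j => y Xiy.
have [_ [k kx ky]] := lb_connected_equiv (Xconn i) Eequiv Erho Xix Xiy.
by rewrite (lb_disjoint_eq Xjhx kx).
Qed.

Variable f : I -> I.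
Hypothesis hf : forall i x, dom (X i) x -> dom (X (f i)) (h x).

Lemma condensation_preimage j y : dom (X j) y ->
  exists i x, [/\ f i = j, dom (X i) x & h x = y].
Proof.
have [_ [_ _ hsurj]] := hcond; move=> Xjy.
have [|x [i _ Xix] hxy] := hsurj y; first by exists j.
exists i, x; split=> //; apply: (@lb_disjoint_eq _ _ y) => //.
by rewrite -hxy; exact: hf.
Qed.

Lemma condensation_surj : set_surj [set: I] [set: I] f.
Proof.
move=> j _; have [y Xjy] := lb_connected_nonempty (Xconn j).
by have [i [x [fi _ _]]] := condensation_preimage Xjy; exists i.
Qed.

Lemma condensation_mono i : lb_mono (X i) (X (f i)) h.
Proof.
have [[_ hhom] [_ hinj _]] := hcond; split; first split.
- by move=> x; exact: hf.
- move=> x y rxy; have [/= Xix _] := rho_sub rxy.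
  by apply: lb_union_rho; [left; exact: hf|apply: hhom; exists i].
- by move=> x y; rewrite !inE => Xix Xiy; apply: hinj; rewrite inE; exists i.
Qed.

Lemma condensation_partition j :
  partition (f @^-1` [set j]) (fun i => h @` dom (X i)) (dom (X j)).
Proof.
have [_ [_ hinj _]] := hcond; split.
- apply/seteqP; split=> [_ [i <- [x Xix <-]]|y /condensation_preimage].
    exact: hf.
  by move=> [i [x [fi Xix hxy]]]; exists i => //; exists x.
- move=> i k _ _ [_ [[x Xix <-] [y Xky hyx]]].
  (* Injectivity of [h] on the whole union is needed here, as [x] and [y] may lie in different
     components. *)
  have yx : y = x by apply: hinj => //; rewrite inE; [exists k|exists i].
  by apply: (@lb_disjoint_eq _ _ x) => //; rewrite -yx.
- move=> i _; have [x Xix] := lb_connected_nonempty (Xconn i).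
  by exists (h x), x.
Qed.

(** Only reflection of edges is at stake. An edge from [h x] lies in [X (f i)], so injectivity of
    [f] puts both [x] and [y] in [X i], where [h] is an isomorphism. *)
Lemma split_iso : set_bij [set: I] [set: I] f ->
  (forall i, lb_iso (X i) (X (f i)) h) -> lb_iso (lb_union X) (lb_union X) h.
Proof.
move=> [_ finj _] hiso; have [[_ hhom] hbij] := hcond; split=> // x y.
move=> [i _ Xix] [k _ Xky]; split; first exact: hhom.
move=> /(lb_union_rho (or_introl (hf Xix))) rxy.
have [/= _ Xfihy] := rho_sub rxy.
have eki : k = i.
  by apply: finj; rewrite ?inE//; exact: lb_disjoint_eq (hf Xky) Xfihy.
rewrite eki in Xky.
by exists i => //; have [_ hrho] := hiso i; apply/hrho.
Qed.

End Split.
End Union.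

Theorem theorem2p2 (U I : Type) (X : I -> lb_structure U)
    (Xdisj : lb_disjoint X) (Xconn : forall i, lb_connected (X i)) :
  lb_reversible (lb_union X) <->
  (forall (f : I -> I) (g : I -> U -> U),
     set_surj [set: I] [set: I] f ->
     (forall i, lb_mono (X i) (X (f i)) (g i)) ->
     (forall j, partition (f @^-1` [set j]) (fun i => g i @` dom (X i))
                          (dom (X j))) ->
     set_bij [set: I] [set: I] f /\
     (forall i, lb_iso (X i) (X (f i)) (g i))).
Proof.
split=> [Xrev f g fsurj gmono gpart|Xfg h hcond].
  exact: reversible_glue.
have /choice[f hf] := condensation_component Xdisj Xconn hcond.
(* Values off [dom (X i)] are irrelevant, so [h] itself serves as each of its restrictions. *)
have [|||fbij hiso] := Xfg f (fun=> h).
- exact: condensation_surj hf.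
- exact: condensation_mono.
- exact: condensation_partition.
exact: split_iso hf fbij hiso.
Qed.
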